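(* Let $q$ and $v$ be real numbers with $q>1$ and $0<v<q$. If we set $x_i=q^{-i}$ and $y_j=vq^{1-j}$ for $i,j=1,2,\ldots$, then the Schur measure $\mathfrak{M}$ specializes to $M_{v,q}$; that is, for every partition $\lambda$, $$\prod_{i,j\ge 1}(1-x_iy_j)\,s_\lambda(x_1,x_2,\ldots)\,s_\lambda(y_1,y_2,\ldots)=M_{v,q}(\lambda).$$
   Context: A partition $\lambda=(\lambda_1\ge\lambda_2\ge\cdots)$ has size $|\lambda|=\sum_i\lambda_i$ and is identified with its Young diagram; the empty partition is allowed; $\lambda'$ denotes the conjugate partition. For a box $x=(i,j)\in\lambda$ the hook-length is $h(x)=\lambda_i+\lambda'_j-i-j+1$. Put $n(\lambda')=\sum_i\lambda_i(\lambda_i-1)/2$. For sequences of variables $x=(x_1,x_2,\ldots)$ and $y=(y_1,y_2,\ldots)$, the Schur measure $\mathfrak{M}$ on the set of all partitions is $$\mathfrak{M}(\lambda)=\prod_{i,j}(1-x_iy_j)\,s_\lambda(x)\,s_\lambda(y),$$ where $s_\lambda$ is the Schur function. For real $q>1$ and $0<v<q$, the measure $M_{v,q}$ on the set of all partitions of all non-negative integers is defined by $$M_{v,q}(\lambda)=\prod_{r=1}^\infty\left(1-vq^{-r}\right)^r\, q^{2n(\lambda')+|\lambda|}\prod_{x\in\lambda}\left(q^{h(x)}-1\right)^{-2}v^{|\lambda|}.$$ *)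

(* Defs.v *)
From HB Require Import structures.
From mathcomp Require Import all_boot all_order all_algebra.
From mathcomp Require Import all_classical all_reals all_analysis.
Import Order.TTheory GRing.Theory Num.Theory.
Import numFieldNormedType.Exports.

Set Implicit Arguments.
Unset Strict Implicit.
Unset Printing Implicit Defensive.

Local Open Scope ring_scope.

(* Rows, columns and boxes are numbered from 0, and a sequence of variables
   x_1, x_2, ... is a function x with x_(i+1) = x i. *)

Record intpart : Type := IntPart {
  parts :> seq nat;
  partsP : sorted geq parts && (0%N \notin parts)
}.

Definition box (la : seq nat) : finType :=
  {i : 'I_(size la) & 'I_(nth 0%N la i)}.

Definition row_of (la : seq nat) (b : box la) : nat := tag b.
Definition col_of (la : seq nat) (b : box la) : nat := tagged b.

Definition conj_part (la : seq nat) (j : nat) : nat :=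
  count (fun l => j < l)%N la.

(* With 1-based i and j this is la_i + la'_j - i - j + 1; on a box the
   truncated subtraction is exact and the value is positive. *)
Definition hook (la : seq nat) (b : box la) : nat :=
  (nth 0 la (row_of b) + conj_part la (col_of b)
     - (row_of b + col_of b).+1)%N.

(* n(la'), where la' is the conjugate of la. *)
Definition n_conj (la : seq nat) : nat :=
  (\sum_(l <- la) (l * (l - 1)) %/ 2)%N.

Definition semistandard (la : seq nat) (n : nat)
    (T : {ffun box la -> 'I_n}) : bool :=
  [forall b : box la, forall c : box la,
    (((row_of b == row_of c) && (col_of b < col_of c)) ==> (T b <= T c))
    && (((col_of b == col_of c) && (row_of b < row_of c)) ==> (T b < T c))]%N.

Section Measures.
Variable R : realType.

Definition schur_poly (n : nat) (la : seq nat) (x : nat -> R) : R :=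
  \sum_(T : {ffun box la -> 'I_n} | semistandard T) \prod_(b : box la) x (T b).

(* The sum of x^T over all semistandard tableaux T with entries in {1, 2, ...},
   as the limit of the sums over tableaux with entries in {1, ..., n}. *)
Definition schur (la : seq nat) (x : nat -> R) : R :=
  limn (fun n => schur_poly n la x).

Definition cauchy_prod (x y : nat -> R) : R :=
  limn (fun n => \prod_(i < n) \prod_(j < n) (1 - x i * y j)).

Definition schur_measure (x y : nat -> R) (la : intpart) : R :=
  cauchy_prod x y * schur la x * schur la y.

Definition M_measure (v q : R) (la : intpart) : R :=
  limn (fun n => \prod_(1 <= r < n.+1) (1 - v * q ^- r) ^+ r)
  * q ^+ (2 * n_conj la + sumn la)
  * (\prod_(b : box la) (q ^+ hook b - 1) ^- 2)
  * v ^+ sumn la.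

End Measures.

(* Main.v *)
Require Import Defs.
From mathcomp Require Import all_boot all_order all_algebra.
From mathcomp Require Import zify ring perm.
From mathcomp Require Import all_classical all_reals all_analysis.
Import Order.TTheory GRing.Theory Num.Theory.
Import numFieldNormedType.Exports.
Local Open Scope ring_scope.

(** Write [t = q^-1].  The three factors of the Schur measure are computed
    separately.

    The Cauchy product runs over [1 - v t^(i+j+1)] with [i, j >= 0].  Grouped
    by [r = i + j + 1] it is the product of [(1 - v t^r)^r]: as all factors lie
    in [0, 1], the partial product over an n by n square lies between the
    partial products over the triangles [i + j < 2n] and [i + j < n], and
    these decrease to a common limit ([square_triangle_limit]).

    Both Schur functions are homogeneous rescalings of [s_la(1, t, t^2, ...)],
    which equals [q^(n(la') + |la|) / \prod_x (q^h(x) - 1)]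
    ([schur_principal]).  This comes from an exact formula in n variables
    ([schur_poly_principal]), a form of the hook-content formula, in which
    each box has a numerator that tends to a power of [q].  The exponents then
    add up: [t^|la| * q^(2 n(la') + 2 |la|) = q^(2 n(la') + |la|)].

    The formula in n variables rests on two facts.

    - The bialternant formula ([bialternant]): the sum over tableaux times the
      Vandermonde determinant is the alternant of the exponents
      [l_i = la_i + n - 1 - i].  Both sides satisfy the same recursion in n.
      Deleting the largest letter from a tableau leaves a tableau whose shape
      interlaces with la ([schur_poly_branching]), and eliminating the last
      column of an alternant turns its rows into geometric sums over the same
      interlacing range ([alternant_branching]).

    - The hook lengths of row i together with the differences [l_i - l_k],
      [k > i], are exactly the integers [1, ..., l_i] ([row_hooks]).  At
      [x_j = t^j] the alternant is a Vandermonde product in the [t^(l_i)], so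
      its differences [q^(l_i - l_k) - 1] are traded for hook lengths
      ([hook_product]). *)

Set Implicit Arguments.
Unset Strict Implicit.
Unset Printing Implicit Defensive.

(** * Boxes and entries of tableaux *)

Lemma box_exists (la : seq nat) i j :
  (j < nth 0 la i)%N -> exists b : box la, row_of b = i /\ col_of b = j.
Proof.
move=> hj.
have hi : (i < size la)%N.
  by rewrite ltnNge; apply/negP => h; rewrite nth_default in hj.
by exists (Tagged (fun i : 'I_(size la) => 'I_(nth 0 la i)%N)
  (Ordinal hj : 'I_(nth 0 la (Ordinal hi)))).
Qed.

Lemma box_inj (la : seq nat) (b c : box la) :
  row_of b = row_of c -> col_of b = col_of c -> b = c.
Proof.
case: b c => [i j] [i' j'] /= /val_inj; rewrite /row_of /=  => e.
case: _ / e j' => j' /=; rewrite /col_of /= => /val_inj e; by case: _ / e.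
Qed.

Lemma col_lt (la : seq nat) (b : box la) :
  (col_of b < nth 0 la (row_of b))%N.
Proof. exact: ltn_ord. Qed.

(** A total entry function on pairs of numbers makes tableaux of different
    shapes comparable without transporting boxes from one shape to another.
    Outside the diagram it takes the value [n], larger than every letter
    [0, ..., n - 1]; this is what makes extending a tableau by the new largest
    letter [n] a mere change of shape. *)
Definition entry (la : seq nat) (n : nat) (T : {ffun box la -> 'I_n})
    (i j : nat) : nat :=
  if [pick b : box la | (row_of b == i) && (col_of b == j)] is Some b
  then T b else n.

Lemma entryE la n (T : {ffun box la -> 'I_n}) b :
  entry T (row_of b) (col_of b) = T b.
Proof.
rewrite /entry; case: pickP => [c /andP [/eqP h /eqP h']|/(_ b)].
  by rewrite (box_inj h h').
by rewrite !eqxx.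
Qed.

Lemma entry_lt la n (T : {ffun box la -> 'I_n}) i j :
  (entry T i j < n)%N = (j < nth 0 la i)%N.
Proof.
rewrite /entry; case: pickP => [c /andP [/eqP <- /eqP <-]|h].
  by rewrite ltn_ord col_lt.
rewrite ltnn; apply/esym/negP => /box_exists [b [hi hj]].
by have := h b; rewrite hi hj !eqxx.
Qed.

Lemma entry_le la n (T : {ffun box la -> 'I_n}) i j : (entry T i j <= n)%N.
Proof. by rewrite /entry; case: pickP => // b _; apply: ltnW. Qed.

Lemma semistandardP la n (T : {ffun box la -> 'I_n}) :
  reflect ((forall i j j', j < j' -> j' < nth 0 la i ->
           entry T i j <= entry T i j')%N
     /\ (forall i i' j, i < i' -> j < nth 0 la i -> j < nth 0 la i' ->
           entry T i j < entry T i' j)%N) (semistandard T).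
Proof.
apply: (iffP idP) => [/forallP h|[h1 h2]].
  split=> [i j j' jj' hj'|i i' j ii' hj hj'].
    have [c [ic jc]] := box_exists hj'.
    have [b [ib jb]] := box_exists (ltn_trans jj' hj').
    have /forallP /(_ c) /andP [/implyP] := h b.
    rewrite -!entryE ib ic jb jc eqxx jj' => H _; exact: H.
  have [c [ic jc]] := box_exists hj'.
  have [b [ib jb]] := box_exists hj.
  have /forallP /(_ c) /andP [_ /implyP] := h b.
  rewrite -!entryE ib ic jb jc eqxx ii' => H; exact: H.
apply/forallP => b; apply/forallP => c; rewrite -!entryE.
apply/andP; split; apply/implyP => /andP [/eqP e l].
  by rewrite e; apply: h1 => //; apply: col_lt.
by rewrite e; apply: h2 => //; rewrite -?e; [apply: col_lt|rewrite e; apply: col_lt].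
Qed.

(** * Removing the largest letter *)

Definition shape_of n B (mu : {ffun 'I_n -> 'I_B}) : seq nat :=
  [seq val (mu i) | i <- enum 'I_n].

Lemma nth_shape_of n B (mu : {ffun 'I_n -> 'I_B}) (i : 'I_n) :
  nth 0%N (shape_of mu) i = mu i.
Proof. by rewrite (nth_map i) ?size_enum_ord // nth_ord_enum. Qed.

Lemma size_shape_of n B (mu : {ffun 'I_n -> 'I_B}) : size (shape_of mu) = n.
Proof. by rewrite size_map size_enum_ord. Qed.

Definition interlacing (la : seq nat) n B (mu : {ffun 'I_n -> 'I_B}) : bool :=
  [forall i : 'I_n, nth 0 la i.+1 <= mu i <= nth 0 la i]%N.

(** Since [entry T] is [n] outside [mu], this fills the boxes of [la] that are
    not in [mu] with the letter [n]. *)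
Definition extend (la mu : seq nat) n (T : {ffun box mu -> 'I_n}) :
    {ffun box la -> 'I_n.+1} :=
  [ffun b => inord (entry T (row_of b) (col_of b))].

Lemma entry_extend la mu n (T : {ffun box mu -> 'I_n}) i j :
  (j < nth 0 la i)%N -> entry (extend la T) i j = entry T i j.
Proof.
move=> /box_exists [b [<- <-]]; rewrite entryE ffunE inordK // ltnS; exact: entry_le.
Qed.

Lemma extend_inj la n B (mu : {ffun 'I_n -> 'I_B}) :
  interlacing la mu -> injective (@extend la (shape_of mu) n).
Proof.
move=> /forallP hmu T T' e; apply/ffunP => c; apply/val_inj => /=.
have hc : (col_of c < nth 0 la (row_of c))%N.
  have h : (row_of c < n)%N by rewrite -[X in (_ < X)%N](size_shape_of mu) ltn_ord.
  have /andP [_] := hmu (Ordinal h); apply: leq_trans.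
  by have := col_lt c; rewrite (nth_shape_of _ (Ordinal h)).
by rewrite -(entryE T c) -(entryE T' c) -[LHS](entry_extend T hc) e entry_extend.
Qed.

(** The shape formed by the letters below [n]; they fill a prefix of every row
    because rows increase weakly, so the first entry that is at least [n]
    marks the end of the row.  Only the first [n] rows are recorded, since
    strictly increasing columns leave no letter below [n] in row [n]. *)
Definition small_shape (la : seq nat) n (T : {ffun box la -> 'I_n.+1}) :
    {ffun 'I_n -> 'I_(nth 0%N la 0).+1} :=
  [ffun i : 'I_n =>
     inord (find (fun j => n <= entry T i j)%N (iota 0 (nth 0%N la i)))].

Lemma sorted_geq_nth la i j :
  sorted geq la -> (i <= j)%N -> (nth 0 la j <= nth 0 la i)%N.
Proof.
move=> s ij; have [h|h] := ltnP j (size la); last by rewrite nth_default.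
apply: (sorted_leq_nth _ _ 0%N s) => //.
- by move=> a b c; rewrite /geq /= => h1 h2; apply: leq_trans h2 h1.
- exact: leqnn.
- exact: leq_ltn_trans h.
Qed.

Lemma small_shapeP la n (T : {ffun box la -> 'I_n.+1}) (i : 'I_n) :
  sorted geq la -> semistandard T ->
  ((small_shape T i <= nth 0 la i)%N *
   (forall j, j < nth 0 la i -> (entry T i j < n) = (j < small_shape T i))%N)%type.
Proof.
move=> s /semistandardP [h1 _]; rewrite ffunE.
set p := (fun j => _ <= _)%N; set l := iota _ _.
have hf : (find p l <= nth 0 la i)%N by rewrite -[X in (_ <= X)%N](size_iota 0) find_size.
rewrite inordK ?ltnS ?(leq_trans hf) ?sorted_geq_nth //; split=> // j hj.
have [jl|jl] := ltnP j (find p l).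
  have := before_find 0%N jl; rewrite nth_iota // add0n.
  by rewrite /p => /negbT; rewrite -ltnNge.
apply/negP/negP; rewrite -leqNgt.
have hp : p (find p l).
  have hh : has p l by rewrite has_find size_iota; apply: leq_ltn_trans hj.
  have := nth_find 0%N hh; rewrite nth_iota ?add0n //; exact: leq_ltn_trans hj.
move: jl; rewrite leq_eqVlt => /orP [/eqP <- //|jl].
exact: leq_trans hp (h1 _ _ _ jl hj).
Qed.

(** A box below a box that contains the largest letter would need a larger
    letter still, so the largest letters form a horizontal strip. *)
Lemma small_shape_interlacing la n (T : {ffun box la -> 'I_n.+1}) :
  sorted geq la -> semistandard T -> interlacing la (small_shape T).
Proof.
move=> s ssT; apply/forallP => i; have [h hT] := small_shapeP i s ssT.
rewrite h andbT leqNgt; apply/negP => lt.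
have lt' := leq_trans lt (sorted_geq_nth s (leqnSn i)).
have := hT _ lt'; rewrite ltnn => /negbT; rewrite -leqNgt => e.
have /semistandardP [_ /(_ i i.+1 _ (ltnSn i) lt' lt)] := ssT.
move=> /(leq_ltn_trans e); have := entry_lt T i.+1 (small_shape T i).
by rewrite lt ltnS => h1 h2; have := leq_trans h2 h1; rewrite ltnn.
Qed.

(** For a fixed interlacing [mu], extension by the largest letter is onto the
    semistandard tableaux whose smaller letters form [mu]; together with
    [extend_inj] this reindexes one fibre of [small_shape]. *)
Lemma mem_extend_image la n (mu : {ffun 'I_n -> 'I_(nth 0 la 0).+1})
    (T : {ffun box la -> 'I_n.+1}) :
  sorted geq la -> (size la <= n.+1)%N -> interlacing la mu ->
  (T \in @extend la (shape_of mu) n @: [set T | semistandard T]%SET)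
  = semistandard T && (small_shape T == mu).
Proof.
move=> s sz imu.
have nmu (i : nat) (hi : (i < n)%N) : nth 0%N (shape_of mu) i = mu (Ordinal hi).
  exact: (nth_shape_of mu (Ordinal hi)).
have nmu_le i : (nth 0 (shape_of mu) i <= nth 0 la i)%N.
  have [hi|hi] := ltnP i n; last by rewrite nth_default ?size_shape_of.
  by rewrite nmu; have /forallP /(_ (Ordinal hi)) /andP [] := imu.
have nmu_ge i : (nth 0 la i.+1 <= nth 0 (shape_of mu) i)%N.
  have [hi|hi] := ltnP i n; last by rewrite [leqLHS]nth_default // (leq_trans sz).
  by rewrite nmu; have /forallP /(_ (Ordinal hi)) /andP [] := imu.
apply/imsetP/andP.
- case=> T'; rewrite inE => /semistandardP [h1 h2] ->.
  have ss : semistandard (extend la T').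
    apply/semistandardP; split=> [i j j' jj' hj'|i i' j ii' hj hj'].
      rewrite !entry_extend ?(ltn_trans jj') //.
      have [hm|hm] := ltnP j' (nth 0 (shape_of mu) i); first exact: h1.
      apply: leq_trans (entry_le _ _ _) _.
      by rewrite leqNgt entry_lt -leqNgt.
    rewrite !entry_extend //.
    have hb : (j < nth 0 (shape_of mu) i)%N.
      apply: leq_trans (nmu_ge i); apply: leq_trans hj' _; exact: sorted_geq_nth.
    have [hm|hm] := ltnP j (nth 0 (shape_of mu) i'); first exact: h2.
    apply: leq_trans (_ : n <= _)%N; first by rewrite entry_lt.
    by rewrite leqNgt entry_lt -leqNgt.
  split=> //; apply/eqP/ffunP => i; apply/val_inj => /=.
  have [le hT] := small_shapeP i s ss.
  have key j : (j < nth 0 la i)%N ->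
      (j < nth 0 (shape_of mu) i)%N = (j < small_shape (extend la T') i)%N.
    by move=> hj; rewrite -hT // entry_extend // entry_lt.
  rewrite nth_shape_of in key.
  have hmu : (mu i <= nth 0 la i)%N by have := nmu_le i; rewrite nth_shape_of.
  apply/eqP; rewrite eqn_leq; apply/andP; split; rewrite leqNgt; apply/negP => lt.
    by have := key _ (leq_trans lt le); rewrite lt ltnn.
  by have := key _ (leq_trans lt hmu); rewrite lt ltnn.
- case=> ss /eqP emu.
  have key i j : (j < nth 0 la i)%N ->
     (entry T i j < n)%N = (j < nth 0 (shape_of mu) i)%N.
    move=> hj; have [hi|hi] := ltnP i n.
      have [_ hT] := small_shapeP (Ordinal hi) s ss.
      by rewrite nmu -emu -hT.
    rewrite nth_default ?size_shape_of // ltn0; apply/negP/negP; rewrite -leqNgt.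
    have hin : i = n.
      apply/eqP; rewrite eqn_leq hi andbT -ltnS; apply: leq_trans sz.
      by rewrite ltnNge; apply/negP => h; rewrite nth_default in hj.
    rewrite hin in hj *.
    have /semistandardP [_ h2] := ss.
    (* Row n has n rows above it, so strict increase down the column forces
       its entries up to n. *)
    have col k : (k <= n)%N -> (k <= entry T k j)%N.
      elim: k => // k IH kn; apply: leq_ltn_trans (IH (ltnW kn)) _.
      by apply: h2 => //; apply: leq_trans hj _; apply: sorted_geq_nth => //; exact: ltnW.
    exact: col.
  have hT (c : box (shape_of mu)) : (entry T (row_of c) (col_of c) < n)%N.
    by rewrite key ?col_lt // (leq_trans (col_lt _)).
  set T' : {ffun box (shape_of mu) -> 'I_n} := [ffun c => Ordinal (hT c)].
  have eT' i j : (j < nth 0 (shape_of mu) i)%N ->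
      entry T' i j = entry T i j.
    by move=> /box_exists [c [<- <-]]; rewrite entryE ffunE.
  exists T'; last first.
    apply/ffunP => b; apply/val_inj; rewrite ffunE /=; rewrite inordK ?ltnS ?entry_le //.
    have [h|h] := ltnP (col_of b) (nth 0 (shape_of mu) (row_of b)).
      by rewrite eT' // entryE.
    have hTb : (n <= T b)%N.
      have := key _ _ (col_lt b); rewrite (ltnNge (col_of b)) h entryE /= => /negbT.
      by rewrite -leqNgt.
    apply/eqP; rewrite eqn_leq (leq_trans (entry_le _ _ _) hTb) andbT.
    apply: leq_trans (_ : n <= _)%N; first by rewrite -ltnS ltn_ord.
    by rewrite leqNgt entry_lt -leqNgt.
  rewrite inE; have /semistandardP [h1 h2] := ss.
  apply/semistandardP; split=> [i j j' jj' hj'|i i' j ii' hj hj'].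
    rewrite !eT' ?(ltn_trans jj') //; apply: h1 => //; exact: leq_trans hj' _.
  by rewrite !eT' //; apply: h2 => //; [apply: leq_trans hj _|apply: leq_trans hj' _].
Qed.

(** The row bound [N] may exceed the number of rows: a missing row has length
    0 and contributes nothing.  This lets shapes with fewer rows than letters
    be treated as if padded with empty rows. *)
Lemma big_box_rows (R : Type) (idx : R) (op : Monoid.com_law idx) (la : seq nat)
    (N : nat) (F : nat -> nat -> R) : (size la <= N)%N ->
  \big[op/idx]_(b : box la) F (row_of b) (col_of b)
  = \big[op/idx]_(i < N) \big[op/idx]_(j < nth 0%N la i) F i j.
Proof.
move=> h; rewrite [RHS](bigID (fun i : 'I_N => (i < size la)%N)) /=.
rewrite [X in op _ X]big1 ?Monoid.mulm1; last first.
  by move=> i; rewrite -leqNgt => hi; rewrite nth_default // big_ord0.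
rewrite -(big_ord_widen _ (fun i => \big[op/idx]_(j < nth 0%N la i) F i j) h).
by rewrite sig_big_dep.
Qed.

Lemma weight_extend (R : realType) n la (mu : {ffun 'I_n -> 'I_(nth 0%N la 0).+1})
    (T : {ffun box (shape_of mu) -> 'I_n}) (x : nat -> R) :
  (size la <= n.+1)%N -> interlacing la mu ->
  \prod_(b : box la) x (extend la T b)
  = x n ^+ nth 0%N la n * (\prod_(i < n) x n ^+ (nth 0%N la i - mu i)%N)
    * \prod_(c : box (shape_of mu)) x (T c).
Proof.
move=> sz imu.
have e_out i j : (nth 0 (shape_of mu) i <= j)%N -> entry T i j = n.
  move=> h; apply/eqP; rewrite eqn_leq entry_le /=.
  by rewrite leqNgt entry_lt -leqNgt.
transitivity (\prod_(b : box la) x (entry T (row_of b) (col_of b))).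
  by apply: eq_bigr => b _; rewrite ffunE inordK // ltnS entry_le.
have -> : \prod_(c : box (shape_of mu)) x (T c) =
   \prod_(c : box (shape_of mu)) x (entry T (row_of c) (col_of c)).
  by apply: eq_bigr => b _; rewrite entryE.
rewrite (big_box_rows _ (fun i j => x (entry T i j)) sz).
rewrite (@big_box_rows _ _ _ _ n (fun i j => x (entry T i j))) ?size_shape_of //.
rewrite big_ord_recr /= mulrC -mulrA -big_split /=; congr (_ * _).
  rewrite (eq_bigr (fun _ => x n)) ?prodr_const ?card_ord // => j _.
  by rewrite e_out // nth_default ?size_shape_of.
apply: eq_bigr => i _; have /forallP /(_ i) /andP [_ le] := imu.
rewrite -(big_mkord xpredT (fun j => x (entry T i j))).
rewrite (@big_cat_nat _ _ _ (mu i)) //= mulrC nth_shape_of big_mkord.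
congr (_ * _); rewrite (@eq_big_nat _ _ _ _ _ _ (fun _ => x n)) ?prodr_const_nat //.
by move=> j /andP [hj _]; rewrite e_out // nth_shape_of.
Qed.

(** Removing the largest letter from a tableau leaves a tableau of an
    interlacing shape, and every interlacing shape arises; the removed boxes
    contribute the powers of [x n].  The shapes [mu] have [n] rows, possibly
    empty, even if [la] has fewer than [n + 1]. *)
Lemma schur_poly_branching (R : realType) n la (x : nat -> R) :
  sorted geq la -> (size la <= n.+1)%N ->
  schur_poly n.+1 la x
  = \sum_(mu : {ffun 'I_n -> 'I_(nth 0%N la 0).+1} | interlacing la mu)
      x n ^+ nth 0%N la n * (\prod_(i < n) x n ^+ (nth 0%N la i - mu i)%N)
      * schur_poly n (shape_of mu) x.
Proof.
move=> s sz; rewrite /schur_poly.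
rewrite (partition_big (@small_shape la n) (@interlacing la _ _)); last first.
  by move=> T; apply: small_shape_interlacing.
apply: eq_bigr => mu imu.
rewrite (eq_bigl (mem (@extend la (shape_of mu) n
  @: [set T | semistandard T]%SET))); last first.
  by move=> T; rewrite /= -mem_extend_image.
rewrite big_imset /=; last by move=> T T' _ _; apply: extend_inj.
rewrite big_distrr /=; apply: eq_big => [T|T _]; first by rewrite inE.
exact: weight_extend.
Qed.

Lemma schur_poly0 (R : realType) (x : nat -> R) : schur_poly 0 [::] x = 1.
Proof.
have no (b : box [::]) : False by case: b => [[]].
rewrite /schur_poly (big_pred1 [ffun b => False_rect _ (no b)]).
  by rewrite big1 // => b; case: (no b).
move=> T /=; have -> : semistandard T by apply/forallP => b; case: (no b).
by apply/esym/eqP/ffunP => b; case: (no b).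
Qed.

(** * Alternants and the bialternant formula *)

Section Alternants.
Variable R : comNzRingType.

(** Each row may be summed separately because every term of the Leibniz
    expansion takes exactly one factor from each row. *)
Lemma sum_det n (J : finType) (Q : 'I_n -> pred J) (F : 'I_n -> 'I_n -> J -> R) :
  \sum_(f in family Q) \det (\matrix_(i, j) F i j (f i))
  = \det (\matrix_(i, j) \sum_(k | Q i k) F i j k).
Proof.
rewrite /determinant exchange_big /=; apply: eq_bigr => s _.
rewrite -big_distrr /=; congr (_ * _).
transitivity (\sum_(f in family Q) \prod_i F i (s i) (f i)).
  by apply: eq_bigr => f _; apply: eq_bigr => i _; rewrite mxE.
rewrite -(bigA_distr_big_dep Q (fun i k => F i (s i) k)).
by apply: eq_bigr => i _; rewrite mxE.
Qed.

(** Row elimination: subtracting [c i] times row [i + 1] from row [i] clears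
    the last column except in its last entry. *)
Lemma det_eliminate_col n (M : nat -> nat -> R) (c : nat -> R) :
  (forall i, (i < n)%N -> M i n = c i * M i.+1 n) ->
  \det (\matrix_(i < n.+1, j < n.+1) M i j)
  = M n n * \det (\matrix_(i < n, j < n) (M i j - c i * M i.+1 j)).
Proof.
move=> hc; set A := \matrix_(i, j) M i j.
pose N : 'M[R]_n.+1 := \matrix_(i, k) (c i *+ (k == i.+1 :> nat)).
have dU : \det (1%:M - N) = 1.
  rewrite -det_tr det_trig; last first.
    apply/is_trig_mxP => i j ij; rewrite !mxE.
    by rewrite -val_eqE /= gtn_eqF // ltn_eqF ?subr0 // ltnS ltnW.
  by rewrite big1 // => i _; rewrite !mxE eqxx (ltn_eqF (ltnSn i)) subr0.
rewrite -[LHS]mul1r -dU -det_mulmx.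
have NA (i j : 'I_n.+1) : (N *m A) i j = if (i < n)%N then c i * M i.+1 j else 0.
  rewrite mxE; case: ifP => hi.
    have hi' : (i.+1 < n.+1)%N by [].
    rewrite (bigD1 (Ordinal hi')) //= !mxE eqxx mulr1n big1 ?addr0 // => k.
    by rewrite -val_eqE /= => /negbTE h; rewrite !mxE h mulr0n mul0r.
  apply: big1 => k _; rewrite !mxE ltn_eqF ?mulr0n ?mul0r //.
  by rewrite (leq_trans (ltn_ord k)) // ltnS leqNgt hi.
rewrite (expand_det_col _ ord_max) (bigD1 ord_max) //= big1 ?addr0; last first.
  move=> i hi; have lt : (i < n)%N.
    by rewrite ltn_neqAle -ltnS ltn_ord andbT; move: hi; rewrite -val_eqE.
  by rewrite mulmxBl mul1mx mxE [X in _ + X]mxE NA lt mxE hc // subrr mul0r.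
rewrite mulmxBl mul1mx mxE [X in _ + X]mxE NA ltnn subr0 mxE; congr (_ * _).
rewrite /cofactor addnn -signr_odd odd_double mul1r; congr (\det _).
apply/matrixP => i j.
have li k : lift ord_max k = k :> nat by rewrite /= /bump leqNgt ltn_ord add0n.
by rewrite mxE mxE mxE [X in _ + X]mxE NA li ltn_ord [in RHS]mxE mxE !li.
Qed.

(** With [b = la_i] and [a = la_(i+1)], this says that one entry of the
    eliminated alternant, divided by [x - y], is the sum over the values that
    an interlacing [mu] may take in row [i]. *)
Lemma telescope_geometric (a b c B : nat) (x y : R) : (a <= b < B)%N ->
  (x - y) * \sum_(m < B | (a <= m <= b)%N) y ^+ (b - m) * x ^+ (m + c)
  = x ^+ (b + c).+1 - y ^+ (b - a).+1 * x ^+ (a + c).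
Proof.
case/andP => ab bB.
have -> : \sum_(m < B | (a <= m <= b)%N) y ^+ (b - m) * x ^+ (m + c)
    = \sum_(a <= m < b.+1) y ^+ (b - m) * x ^+ (m + c).
  rewrite (big_nat_widen _ _ B) // (big_nat_widenl _ 0) // big_mkord.
  by apply: eq_bigl => m; rewrite andTb andbC.
rewrite -{1}[a]add0n big_addn big_mkord subSn //.
have -> : (b + c).+1 = ((b - a).+1 + (a + c))%N by rewrite addSn addnA subnK.
rewrite exprD -mulrBl subrXX -mulrA; congr (_ * _); rewrite big_distrl /=.
rewrite (reindex_inj rev_ord_inj) /=; apply: eq_bigr => i _.
have hi : (i <= b - a)%N by rewrite -ltnS.
rewrite subSS -addnA exprD mulrA; congr (_ * _).
rewrite mulrC; congr (_ * _ ^+ _).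
by rewrite subnDA subnAC subKn.
Qed.

(** The exponents [la + delta] of the bialternant formula, where
    [delta = (n - 1, ..., 1, 0)]. *)
Definition staircase (la : seq nat) (n i : nat) : nat :=
  (nth 0%N la i + (n.-1 - i))%N.

Definition alternant (n : nat) (x : nat -> R) (l : nat -> nat) : R :=
  \det (\matrix_(i < n, j < n) x j ^+ l i).

(** In the alternant of size [n + 1], eliminating the last column by the
    multiples [x_n^(l_i - l_(i+1))] of the next row leaves the entries
    [x_j^(l_i) - x_n^(l_i - l_(i+1)) x_j^(l_(i+1))].  Dividing column [j] by
    [x_j - x_n] turns them into geometric sums, and expanding the determinant
    in these sums gives one alternant of size [n] for each interlacing [mu]. *)
Lemma alternant_branching n la (x : nat -> R) :
  sorted geq la ->
  (\prod_(j < n) (x j - x n))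
   * (\sum_(mu : {ffun 'I_n -> 'I_(nth 0%N la 0).+1} | interlacing la mu)
      x n ^+ nth 0%N la n * (\prod_(i < n) x n ^+ (nth 0%N la i - mu i)%N)
      * alternant n x (staircase (shape_of mu) n))
  = alternant n.+1 x (staircase la n.+1).
Proof.
move=> s.
pose Q (i : 'I_n) (m : 'I_(nth 0%N la 0).+1) := (nth 0 la i.+1 <= m <= nth 0 la i)%N.
pose F (i j : 'I_n) (m : 'I_(nth 0%N la 0).+1) :=
  x n ^+ (nth 0%N la i - m) * x j ^+ (m + (n.-1 - i)).
have -> : \sum_(mu : {ffun 'I_n -> 'I_(nth 0%N la 0).+1} | interlacing la mu)
      x n ^+ nth 0%N la n * (\prod_(i < n) x n ^+ (nth 0%N la i - mu i)%N)
      * alternant n x (staircase (shape_of mu) n)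
   = x n ^+ nth 0%N la n * \det (\matrix_(i, j) \sum_(m | Q i m) F i j m).
  rewrite -sum_det big_distrr /=; apply: eq_big => [mu|mu _].
    by apply/forallP/familyP => h i; have := h i.
  rewrite -mulrA; congr (_ * _).
  transitivity (\det (diag_mx (\row_i x n ^+ (nth 0%N la i - mu i))
       *m (\matrix_(i, j) x j ^+ staircase (shape_of mu) n i))).
    by rewrite det_mulmx det_diag; congr (_ * _); apply: eq_bigr => i _; rewrite mxE.
  rewrite mul_diag_mx; congr (\det _); apply/matrixP => i j; rewrite !mxE.
  by rewrite /staircase nth_shape_of.
have stair i : (i < n)%N -> staircase la n.+1 i = (nth 0%N la i + (n.-1 - i)).+1.
  by move=> hi; rewrite /staircase /= -addnS -predn_sub prednK ?subn_gt0.
rewrite /alternant (@det_eliminate_col _ (fun i j => x j ^+ staircase la n.+1 i)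
   (fun i => x n ^+ (nth 0%N la i - nth 0%N la i.+1).+1)); last first.
  move=> i hi; rewrite -exprD stair // /staircase /= addSn; congr (_ ^+ _.+1).
  by rewrite addnA subnK ?sorted_geq_nth // subnS predn_sub.
rewrite mulrCA; congr (_ * _); first by rewrite /staircase /= subnn addn0.
transitivity (\det ((\matrix_(i < n, j < n) \sum_(m | Q i m) F i j m)
   *m diag_mx (\row_j (x j - x n)))).
  rewrite det_mulmx det_diag mulrC; congr (_ * _).
  by apply: eq_bigr => i _; rewrite mxE.
rewrite mul_mx_diag; congr (\det _); apply/matrixP => i j; rewrite !mxE mulrC.
rewrite telescope_geometric; last by rewrite ltnS !sorted_geq_nth.
by rewrite stair // /staircase /= subnS predn_sub.
Qed.
End Alternants.

Lemma sorted_shape_of la n (mu : {ffun 'I_n -> 'I_(nth 0%N la 0).+1}) :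
  interlacing la mu -> sorted geq (shape_of mu).
Proof.
move=> /forallP imu; apply/(sortedP 0%N) => i; rewrite size_shape_of => hi.
have := imu (Ordinal hi); have := imu (Ordinal (ltnW hi)).
rewrite -!nth_shape_of /= => /andP [h _] /andP [_ h']; exact: leq_trans h' h.
Qed.

(** Jacobi's formula, without division.  Both sides obey the same branching
    rule; the factors [x_j - x_n] that it costs are absorbed by the Vandermonde
    determinant, to which [alternant_branching] applies with [la = [::]]. *)
Lemma bialternant (R : realType) n la (x : nat -> R) :
  sorted geq la -> (size la <= n)%N ->
  schur_poly n la x * alternant n x (staircase [::] n)
  = alternant n x (staircase la n).
Proof.
elim: n la => [|n IH] la s sz.
  move: sz; rewrite leqn0 size_eq0 => /eqP ->.
  by rewrite schur_poly0 mul1r.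
rewrite schur_poly_branching // -!alternant_branching //.
(* The empty shape is interlaced only by itself. *)
pose mu0 : {ffun 'I_n -> 'I_(nth 0%N [::] 0).+1} := [ffun=> ord0].
rewrite (big_pred1 mu0) /=; last first.
  move=> mu /=; apply/forallP/eqP => [h|-> i]; last by rewrite ffunE !nth_nil.
  apply/ffunP => i; apply/val_inj; rewrite ffunE /=.
  by have /andP [_] := h i; rewrite nth_nil leqn0 => /eqP.
rewrite nth_nil expr0 mul1r [X in X * alternant _ _ _]big1 ?mul1r; last first.
  by move=> i _; rewrite nth_nil expr0.
rewrite mulrCA; congr (_ * _); rewrite big_distrl /=; apply: eq_bigr => mu imu.
rewrite -(IH (shape_of mu)) ?size_shape_of ?(sorted_shape_of imu) // mulrA.
congr (_ * _ * _).
congr (\det _); apply/matrixP => i j; rewrite !mxE /staircase nth_nil.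
by rewrite nth_shape_of ffunE.
Qed.

(** * Hook lengths *)

(** The numbers [m 0 >= m 1 >= ...] are the rows below a top row of length [a],
    so that the first product runs over the hook lengths of that top row.  In
    the induction a new last row of length [c = m s] lengthens the hooks in the
    first [c] columns by one: the consecutive values
    [a + s - c + 1, ..., a + s] move up by one, and the new factor
    [a - c + s + 1] fills the gap that they leave. *)
Lemma top_row_hooks (R : comNzRingType) (f : nat -> R) (a s : nat)
    (m : nat -> nat) :
  (forall i j, (i <= j)%N -> (m j <= m i)%N) -> (m 0 <= a)%N ->
  (\prod_(j < a) f (a - j + \sum_(k < s) (j < m k))%N)
   * (\prod_(k < s) f (a - m k + k.+1)%N)
  = \prod_(1 <= k < (a + s).+1) f k.
Proof.
move=> hm ma; elim: s => [|s IH].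
  rewrite big_ord0 mulr1 addn0 (reindex_inj rev_ord_inj) /=.
  rewrite big_add1 big_mkord; apply: eq_bigr => j _.
  by rewrite big_ord0 addn0 subKn.
rewrite addnS big_nat_recr //= -IH big_ord_recr /= [X in _ * X = _]mulrC mulrA
  [RHS]mulrAC; congr (_ * _).
have ca : (m s <= a)%N by apply: leq_trans ma; apply: hm.
pose G t j := f (a - j + \sum_(k < t) (j < m k))%N.
have split_row t : \prod_(j < a) f (a - j + \sum_(k < t) (j < m k))%N
    = \prod_(0 <= j < m s) G t j * \prod_(m s <= j < a) G t j.
  by rewrite -big_cat_nat // big_mkord.
rewrite (split_row s.+1) (split_row s) mulrAC [RHS]mulrAC.
congr (_ * _); last first.
  apply: eq_big_nat => j /andP [hj _]; by rewrite /G big_ord_recr /= ltnNge hj addn0.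
have full t j : (t <= s.+1)%N -> (j < m s)%N -> (\sum_(k < t) (j < m k))%N = t.
  move=> ht hj; rewrite (eq_bigr (fun _ => 1%N)) ?sum1_card ?card_ord // => k _.
  by rewrite (leq_trans hj) // hm // -ltnS (leq_trans _ ht).
rewrite (@eq_big_nat _ _ _ _ _ (G s.+1) (fun j => f (a - j + s.+1)%N)); last first.
  by move=> j /andP [_ hj]; rewrite /G full.
rewrite (@eq_big_nat _ _ _ _ _ (G s) (fun j => f (a - j.+1 + s.+1)%N)); last first.
  move=> j /andP [_ hj]; rewrite /G full // addnS -addSn -subSn ?subSS //.
  exact: leq_trans hj ca.
transitivity (\prod_(0 <= j < (m s).+1) f (a - j + s.+1)%N).
  by rewrite big_nat_recr.
by rewrite big_nat_recl // subn0 addnS mulrC.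
Qed.

Lemma conj_part_sum la n j : (size la <= n)%N ->
  conj_part la j = (\sum_(k < n) (j < nth 0 la k))%N.
Proof.
move=> sz; rewrite /conj_part -sum1_count big_mkcond /= (big_nth 0%N) big_mkord.
rewrite (big_ord_widen _ (fun k => if (j < nth 0 la k)%N then 1%N else 0%N) sz).
rewrite big_mkcond; apply: eq_bigr => k _; case: ltnP => [|h]; first by case: ltnP.
by rewrite nth_default.
Qed.

(** The hooks of row [i] do not depend on the rows above it, so row [i] may be
    taken as the top row of the shape formed by it and the rows below. *)
Lemma row_hooks (R : comNzRingType) (f : nat -> R) la n (i : 'I_n) :
  sorted geq la -> (size la <= n)%N ->
  (\prod_(j < nth 0%N la i) f (nth 0 la i + conj_part la j - (i + j).+1)%N)
  * (\prod_(k < n | (i < k)%N) f (staircase la n i - staircase la n k)%N)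
  = \prod_(1 <= k < (staircase la n i).+1) f k.
Proof.
move=> s sz.
have hn : (i.+1 + (n.-1 - i) = n)%N.
  by have := ltn_ord i; lia.
have sz' : (size la <= i.+1 + (n.-1 - i))%N by rewrite hn.
rewrite /staircase -(@top_row_hooks _ f _ _ (fun k => nth 0%N la (i.+1 + k))%N).
- congr (_ * _).
    apply: eq_bigr => j _; congr f; rewrite (conj_part_sum j sz').
    rewrite big_split_ord /= (eq_bigr (fun _ => 1%N)); last first.
      by move=> k _; rewrite (leq_trans (ltn_ord j)) // sorted_geq_nth // -ltnS.
    rewrite sum1_card card_ord.
    have := ltn_ord j; set S := (\sum_(k < _) _)%N; lia.
  pose F k := f (staircase la n i - staircase la n k)%N.
  transitivity (\prod_(k < n.-1 - i) F (i.+1 + k)%N).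
    rewrite -(big_mkord xpredT (fun k => F (i.+1 + k)%N)).
    rewrite -(@big_geq_mkord _ _ _ i.+1 n xpredT F) -{1}[i.+1]add0n big_addn.
    have -> : (n - i.+1 = n.-1 - i)%N by lia.
    by apply: eq_bigr => k _; rewrite addnC.
  apply: eq_bigr => k _; congr f; rewrite /staircase.
  have : (nth 0 la (i.+1 + k) <= nth 0 la i)%N by apply: sorted_geq_nth => //; lia.
  by have := ltn_ord k; lia.
- by move=> k k' h; apply: sorted_geq_nth => //; rewrite leq_add2l.
- by apply: sorted_geq_nth => //; rewrite addn0.
Qed.

Lemma hook_product (R : comNzRingType) (f : nat -> R) la n :
  sorted geq la -> (size la <= n)%N ->
  (\prod_(b : box la) f (hook b))
  * (\prod_(i < n) \prod_(k < n | (i < k)%N)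
       f (staircase la n i - staircase la n k)%N)
  = \prod_(i < n) \prod_(1 <= k < (staircase la n i).+1) f k.
Proof.
move=> s sz.
rewrite (big_box_rows _
  (fun i j => f (nth 0 la i + conj_part la j - (i + j).+1)%N) sz).
by rewrite -big_split /=; apply: eq_bigr => i _; apply: row_hooks.
Qed.

(** The subtraction in [hook] is truncated, so positivity uses that the column
    of a box reaches at least down to that box. *)
Lemma hook_gt0 la (b : box la) : sorted geq la -> (0 < hook b)%N.
Proof.
move=> s; have h := col_lt b.
have : (row_of b < conj_part la (col_of b))%N.
  rewrite (conj_part_sum _ (leqnn _)); move: (col_of b) h => j h.
  rewrite -(big_mkord xpredT (fun k => (j < nth 0 la k)%N : nat)).
  rewrite (@big_cat_nat _ _ _ (row_of b).+1) //=; last exact: ltn_ord.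
  apply: leq_trans (leq_addr _ _).
  rewrite (@eq_big_nat _ _ _ _ _ _ (fun=> 1%N)) ?sum_nat_const_nat ?subn0 ?muln1 //.
  by move=> k /andP [_ hk]; rewrite (leq_trans h) // sorted_geq_nth.
rewrite /hook; lia.
Qed.

(** * Principal specialization *)

Lemma sumnE_nth la : sumn la = (\sum_(i < size la) nth 0%N la i)%N.
Proof. by rewrite sumnE (big_nth 0%N) big_mkord. Qed.

Lemma schur_poly_scale (R : realType) n la (c : R) (x : nat -> R) :
  schur_poly n la (fun j => c * x j) = c ^+ sumn la * schur_poly n la x.
Proof.
rewrite /schur_poly big_distrr /=; apply: eq_bigr => T _.
rewrite big_split /=; congr (_ * _).
rewrite (@big_box_rows _ _ _ la (size la) (fun _ _ => c)) // sumnE_nth -prodrXr.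
by apply: eq_bigr => i _; rewrite prodr_const card_ord.
Qed.

Lemma prod_expr_col (R : realType) (q : R) la :
  \prod_(b : box la) q ^+ (col_of b).+1 = q ^+ (n_conj la + sumn la).
Proof.
rewrite (@big_box_rows _ _ _ la (size la) (fun _ j => q ^+ j.+1)) //.
rewrite /n_conj sumnE_nth (big_nth 0%N) big_mkord -big_split /= -prodrXr.
apply: eq_bigr => i _; rewrite prodrXr; congr (_ ^+ _).
rewrite (eq_bigr (fun j : 'I_(nth 0%N la i) => (j + 1)%N)); last first.
  by move=> j _; rewrite addn1.
rewrite big_split /= sum1_card card_ord -(big_mkord xpredT id).
by rewrite bin2_sum bin2 subn1 divn2.
Qed.

Section Principal.
Variables (R : realType) (q : R).
Hypothesis q1 : 1 < q.

Let q0 : q != 0. Proof. by rewrite gt_eqF // (lt_trans _ q1). Qed.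

Lemma staircase_lt la n i k : sorted geq la -> (i < k < n)%N ->
  (staircase la n k < staircase la n i)%N.
Proof.
by move=> s ikn; have := @sorted_geq_nth la i k s; rewrite /staircase; lia.
Qed.

(** At [x_j = q^-j] the alternant is the transpose of a Vandermonde matrix in
    the [q^-(l_i)], and
    [q^-(l_k) - q^-(l_i) = q^-(l_i) * (q^(l_i - l_k) - 1)]. *)
Lemma alternant_principal la n : sorted geq la ->
  alternant n (fun j => q ^- j) (staircase la n)
  = (\prod_(i < n) q ^- (staircase la n i * (n.-1 - i)))
    * \prod_(i < n) \prod_(k < n | (i < k)%N)
        (q ^+ (staircase la n i - staircase la n k) - 1).
Proof.
move=> s; rewrite /alternant.
have -> : \matrix_(i < n, j < n) (q ^- j) ^+ staircase la n i
   = (Vandermonde n (\row_i q ^- staircase la n i))^T.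
  by apply/matrixP => i j; rewrite !mxE -!exprVn -!exprM mulnC.
rewrite det_tr det_Vandermonde -big_split /=; apply: eq_bigr => i _.
have -> : q ^- (staircase la n i * (n.-1 - i))
    = \prod_(k < n | (i < k)%N) q ^- staircase la n i.
  rewrite -(@big_geq_mkord _ _ _ i.+1 n xpredT (fun=> q ^- staircase la n i)).
  rewrite prodr_const_nat -!exprVn -exprM; congr (_ ^+ (_ * _)); lia.
rewrite -big_split /=; apply: eq_bigr => k ik; rewrite !mxE.
have lt : (staircase la n k < staircase la n i)%N.
  by apply: staircase_lt; rewrite // ik ltn_ord.
rewrite mulrBr mulr1 -{2}(subnK (ltnW lt)) exprD invfM mulrAC mulVf ?expf_neq0 //.
by rewrite mul1r.
Qed.

(** A form of the hook-content formula: the exponent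
    [n - 1 - row + (col + 1)] is [n] plus the content of the box. *)
Lemma schur_poly_principal la n : sorted geq la -> (size la <= n)%N ->
  schur_poly n la (fun j => q ^- j) * \prod_(b : box la) (q ^+ hook b - 1)
  = \prod_(b : box la)
      (q ^+ (col_of b).+1 * (1 - q ^- (n.-1 - row_of b + (col_of b).+1))).
Proof.
move=> s sz; pose f k : R := q ^+ k - 1.
have f_neq0 k : (0 < k)%N -> f k != 0.
  by move=> k0; rewrite subr_eq0 gt_eqF // exprn_egt1 // -lt0n.
have alt_hook mu : sorted geq mu -> (size mu <= n)%N ->
    alternant n (fun j => q ^- j) (staircase mu n) * \prod_(b : box mu) f (hook b)
    = \prod_(i < n) (q ^- (staircase mu n i * (n.-1 - i))
        * \prod_(1 <= k < (staircase mu n i).+1) f k).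
  move=> smu szmu; rewrite alternant_principal // -mulrA [RHS]big_split /=.
  by rewrite -(hook_product f smu szmu); congr (_ * _); rewrite mulrC.
(* The bialternant formula is cleared of its denominator by the empty shape,
   whose alternant is D. *)
have := alt_hook la s sz; have := alt_hook [::] isT isT.
rewrite [X in _ * X = _]big1 ?mulr1; last by case=> -[].
rewrite -(@bialternant _ n la) // => -> e.
set D := \prod_(i < n) _ in e.
have D0 : D != 0.
  apply/prodf_neq0 => i _; rewrite mulf_neq0 ?invr_neq0 ?expf_neq0 //.
  rewrite prodf_seq_neq0; apply/allP => k; rewrite mem_index_iota.
  by case/andP => k0 _; exact: f_neq0.
apply: (mulIf D0); rewrite mulrAC e.
rewrite (big_box_rows _ (fun i j => q ^+ j.+1 * (1 - q ^- (n.-1 - i + j.+1))) sz).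
rewrite -big_split /=; apply: eq_bigr => i _.
rewrite /staircase nth_nil add0n; set d := (n.-1 - i)%N; set a := nth _ _ _.
rewrite (@big_cat_nat _ _ _ d.+1 1 (a + d).+1) //=; last by rewrite ltnS leq_addl.
rewrite mulnDl exprD invfM [q ^- _ * q ^- _]mulrC mulrACA [RHS]mulrC; congr (_ * _).
rewrite -{1}[d.+1]add0n big_addn subSS addnK big_mkord.
have -> : q ^- (a * d) = \prod_(j < a) q ^- d.
  by rewrite prodr_const card_ord exprVn -exprM mulnC.
rewrite -big_split /=; apply: eq_bigr => j _.
rewrite /f addnS -addSn addnC exprD.
have := expf_neq0 d q0; have := expf_neq0 j.+1 q0.
by move: (q ^+ d) (q ^+ j.+1) => X Y Y0 X0; field; rewrite X0 Y0.
Qed.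

Local Open Scope classical_set_scope.

Lemma schur_principal (c : R) la : sorted geq la ->
  schur la (fun j => c * q ^- j)
  = c ^+ sumn la * q ^+ (n_conj la + sumn la)
    / \prod_(b : box la) (q ^+ hook b - 1).
Proof.
move=> s; set H := \prod_b _.
have H0 : H != 0.
  apply/prodf_neq0 => b _; rewrite subr_eq0 gt_eqF // exprn_egt1 // -lt0n hook_gt0 //.
have lim_factor (i j : nat) :
    (fun n : nat => q ^+ j.+1 * (1 - q ^- (n.-1 - i + j.+1))) @ \oo --> q ^+ j.+1.
  have {2}-> : q ^+ j.+1 = q ^+ j.+1 * (1 - 0) by rewrite subr0 mulr1.
  apply: cvgM; first exact: cvg_cst.
  apply: cvgB; first exact: cvg_cst.
  rewrite -(cvg_shiftn i.+1).
  have -> : [sequence q ^- ((n + i.+1)%N.-1 - i + j.+1)]_n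
      = (fun n => q^-1 ^+ (n + j.+1)).
    by apply/funext => n; rewrite exprVn; congr (q ^- (_ + _)); lia.
  rewrite (cvg_shiftn j.+1 (fun n => q^-1 ^+ n)).
  have qgt0 : 0 < q := lt_trans ltr01 q1.
  by apply: cvg_expr; rewrite gtr0_norm ?invr_gt0 // invf_lt1.
apply/cvg_lim => //.
rewrite -(cvg_shiftn (size la)).
have -> : [sequence schur_poly (n + size la) la (fun j => c * q ^- j)]_n
  = (fun n => c ^+ sumn la * (\prod_(b : box la)
      (q ^+ (col_of b).+1
       * (1 - q ^- ((n + size la)%N.-1 - row_of b + (col_of b).+1))) / H)).
  apply/funext => n; rewrite /= (schur_poly_scale _ _ _ (fun j => q ^- j)).
  congr (_ * _).
  by rewrite -schur_poly_principal ?leq_addl // mulfK.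
rewrite -prod_expr_col -mulrA.
apply: cvgM; first exact: cvg_cst.
apply: cvgM; last exact: cvg_cst.
apply: cvg_big; first exact: mul_continuous.
move=> b _.
by rewrite (cvg_shiftn (size la) (fun n : nat => q ^+ (col_of b).+1 *
   (1 - q ^- (n.-1 - row_of b + (col_of b).+1)))).
Qed.

End Principal.

(** * The Cauchy product *)

Section CauchyProduct.
Variable R : realType.
Local Open Scope classical_set_scope.

Lemma prod_le_prefix (g : nat -> R) m n :
  (forall i, 0 <= g i <= 1) -> (m <= n)%N ->
  \prod_(i < n) g i <= \prod_(i < m) g i.
Proof.
move=> hg mn; rewrite -!(big_mkord xpredT g) (@big_cat_nat _ _ _ m _ n) //=.
rewrite ler_piMr ?prodr_ge0 //; first by move=> i _; case/andP: (hg i).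
by apply: prodr_ile1 => i _.
Qed.

Lemma triangle_prod (g : nat -> R) n :
  \prod_(1 <= r < n.+1) g r ^+ r = \prod_(i < n) \prod_(j < n - i) g (i + j).+1.
Proof.
elim: n => [|n IH]; first by rewrite big_ord0 big_geq.
rewrite big_nat_recr //= IH big_ord_recr /= subSnn big_ord1 addn0.
have -> : \prod_(i < n) \prod_(j < n.+1 - i) g (i + j).+1
   = \prod_(i < n) (\prod_(j < n - i) g (i + j).+1 * g n.+1).
  apply: eq_bigr => i _; have le := ltnW (ltn_ord i).
  by rewrite subSn // big_ord_recr /= subnKC.
by rewrite big_split /= prodr_const card_ord -mulrA exprSr.
Qed.

(** The square [i, j < n] contains the triangle [i + j < n] and lies in the
    triangle [i + j < 2n].  Factors in [0, 1] make the partial products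
    decrease along inclusions, so the square is squeezed between two
    subsequences of one convergent sequence. *)
Lemma square_triangle_limit (g : nat -> R) : (forall r, 0 <= g r.+1 <= 1) ->
  limn (fun n => \prod_(i < n) \prod_(j < n) g (i + j).+1)
  = limn (fun n => \prod_(1 <= r < n.+1) g r ^+ r).
Proof.
move=> hg; set D := fun n => \prod_(1 <= r < n.+1) _.
have prod01 (I : finType) (F : I -> R) :
    (forall i, 0 <= F i <= 1) -> 0 <= \prod_i F i <= 1.
  move=> hF; rewrite prodr_ge0 /=; last by move=> i _; case/andP: (hF i).
  by apply: prodr_ile1 => i _.
have powr01 r k : 0 <= g r.+1 ^+ k <= 1.
  by case/andP: (hg r) => h0 h1; rewrite exprn_ge0 ?exprn_ile1.
have cvD : cvgn D.
  apply: nonincreasing_is_cvgn.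
    move=> m n mn; rewrite /D !big_add1 !big_mkord /=.
    exact: (prod_le_prefix (g := fun r => g r.+1 ^+ r.+1)).
  exists 0 => _ [n _ <-]; rewrite /D big_add1.
  by apply: prodr_ge0 => r _; case/andP: (powr01 r r.+1).
apply/cvg_lim => //.
apply: (@squeeze_cvgr _ _ _ _ (fun n => D (n + n)%N) D) => //; last first.
  apply: (cvg_comp (fun n => n + n)%N D _ cvD).
  apply/cvgnyPge => A; near=> n.
  by rewrite (leq_trans _ (leq_addr _ _)) //; near: n; exists A.
near=> n; rewrite /D !triangle_prod; apply/andP; split.
- apply: le_trans (_ : \prod_(i < n) \prod_(j < n + n - i) g (i + j).+1 <= _).
    apply: (prod_le_prefix (g := fun i => \prod_(j < n + n - i) g (i + j).+1));
      last exact: leq_addr.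
    by move=> i; apply: prod01.
  apply: ler_prod => i _; rewrite prodr_ge0 /=; last first.
    by move=> j _; case/andP: (hg (i + j)%N).
  apply: (prod_le_prefix (g := fun j => g (i + j).+1)) => //.
  by rewrite -addnBA ?leq_addr // ltnW.
- apply: ler_prod => i _; rewrite prodr_ge0 /=; last first.
    by move=> j _; case/andP: (hg (i + j)%N).
  by apply: (prod_le_prefix (g := fun j => g (i + j).+1)) => //; exact: leq_subr.
Unshelve. all: by end_near.
Qed.

End CauchyProduct.

(** * The Schur measure *)

Theorem proposition2 (R : realType) (q v : R) (hq : 1 < q) (hv0 : 0 < v)
    (hvq : v < q) (la : intpart) :
  schur_measure (fun i : nat => q ^- i.+1) (fun j : nat => v * q ^- j) la
  = M_measure v q la.
Proof.
have q0 : 0 < q := lt_trans ltr01 hq.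
have s : sorted geq la by have /andP [] := partsP la.
pose g r := 1 - v * q ^- r.
have hg r : 0 <= g r.+1 <= 1.
  rewrite /g; apply/andP; split.
    rewrite subr_ge0 ler_pdivrMr ?exprn_gt0 // mul1r (le_trans (ltW hvq)) //.
    by rewrite ler_eXnr // ltW.
  by rewrite gerBl divr_ge0 ?exprn_ge0 // ltW.
have cauchy : cauchy_prod (fun i : nat => q ^- i.+1) (fun j : nat => v * q ^- j)
    = limn (fun n => \prod_(1 <= r < n.+1) g r ^+ r).
  rewrite -square_triangle_limit // /cauchy_prod; congr (limn _).
  apply/funext => n; apply: eq_bigr => i _; apply: eq_bigr => j _.
  by rewrite /g mulrCA -invfM -exprD addSn.
have schur_x : schur la (fun i : nat => q ^- i.+1)
    = schur la (fun i => q^-1 * q ^- i).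
  by congr (schur la _); apply/funext => i; rewrite exprS invfM.
rewrite /schur_measure /M_measure cauchy schur_x !schur_principal //.
rewrite -!mulrA; congr (_ * _).
have -> : \prod_(b : box la) (q ^+ hook b - 1) ^- 2
    = (\prod_(b : box la) (q ^+ hook b - 1))^-1
      * (\prod_(b : box la) (q ^+ hook b - 1))^-1.
  by rewrite -prodfV -big_split; apply: eq_bigr => b _; rewrite expr2 invfM.
have -> : (2 * n_conj la + sumn la = n_conj la + (n_conj la + sumn la))%N by lia.
rewrite !exprD exprVn; have := expf_neq0 (sumn la) (lt0r_neq0 q0).
move: (q ^+ sumn la) (q ^+ n_conj la) (v ^+ _) (\prod_b _)^-1 => S N V H S0.
by field.
Qed.
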